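(* Let $f\colon\mathcal{E}\to\overline{\mathbb{R}}_{++}$ be upper semicontinuous and strictly upper radial with $R(f)>0$ and $\sup f\in\mathbb{R}_{++}$, and let $x^*,y^*\in\mathcal{E}$ satisfy $(y^*,f^\Gamma(y^* ))=\Gamma(x^*,f(x^* ))$. Let $\theta\in[0,1)$. Suppose $x^*$ is a local maximum of $f$ at which the Łojasiewicz condition with exponent $\theta$ holds: there are $r>0$, $C>0$ such that every $x\in B(x^*,r)$ satisfies $f(x)\le f(x^* )$ and $$\mathrm{dist}(0,\partial^P f(x))\ge C\,(f(x^* )-f(x))^\theta .$$ Then $y^*$ is a local minimum of $f^\Gamma$ at which the Łojasiewicz condition with the same exponent $\theta$ holds: there are $r'>0$, $C'>0$ such that every $y\in B(y^*,r')$ satisfies $f^\Gamma(y)\ge f^\Gamma(y^* )$ and $$\mathrm{dist}(0,\partial_P f^\Gamma(y))\ge C'\,(f^\Gamma(y)-f^\Gamma(y^* ))^\theta .$$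
   Context: $\mathcal{E}$ is a finite-dimensional Euclidean space with norm $\|\cdot\|$; $B(x,r)$ is the ball of radius $r$ about $x$; $\overline{\mathbb{R}}_{++}=\mathbb{R}_{++}\cup\{0,+\infty\}$. For $f\colon\mathcal{E}\to\overline{\mathbb{R}}_{++}$: $\mathrm{epi}\,f=\{(x,u)\in\mathcal{E}\times\mathbb{R}_{++}: f(x)\le u\}$, $\mathrm{hypo}\,f=\{(x,u)\in\mathcal{E}\times\mathbb{R}_{++}: f(x)\ge u\}$; $f$ is upper semicontinuous if $\mathrm{hypo}\,f$ is closed relative to $\mathcal{E}\times\mathbb{R}_{++}$. The function $f$ is upper radial if for every $y$ the function $v\mapsto v\cdot f(y/v)$ is upper semicontinuous and nondecreasing on $\mathbb{R}_{++}$; it is strictly upper radial if moreover this function is strictly increasing in $v$ wherever $v\cdot f(y/v)\in\mathbb{R}_{++}$. With $\Gamma(x,u)=(x,1)/u$, the radial dual is $f^\Gamma(y)=\sup\{v>0: (y,v)\in\Gamma(\mathrm{epi}\,f)\}=\sup\{v>0: v\cdot f(y/v)\le 1\}$, with $\sup\emptyset=0$. Proximal normals of $S\subseteq\mathcal{E}\times\mathbb{R}$ at $(x,u)\in S$: $N^P_S((x,u))=\{(\zeta,\delta): (x,u)\text{ is a nearest point of }S\text{ to }(x,u)+\epsilon(\zeta,\delta)\text{ for some }\epsilon>0\}$. Proximal sub- and supdifferentials: $\partial_P f(x)=\{\zeta:(\zeta,-1)\in N^P_{\mathrm{epi}\,f}((x,f(x)))\}$ and $\partial^P f(x)=\{\zeta:(-\zeta,1)\in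 N^P_{\mathrm{hypo}\,f}((x,f(x)))\}$ when $f(x)\in\mathbb{R}_{++}$, and empty otherwise. The distance to the empty set is $+\infty$, and $0^0$ is read as $0$ when $\theta=0$. $R(f)=\inf\{\|x'\| : (x,u)\in\mathrm{hypo}\,f,\ 0\ne(\zeta,\delta)\in N^P_{\mathrm{hypo}\,f}((x,u)),\ x'\in\mathcal{E},\ (\zeta,\delta)^T((x',0)-(x,u))=0\}$, with $\inf\emptyset=+\infty$. *)

(* Defs.v *)
From HB Require Import structures.
From mathcomp Require Import all_boot all_order all_algebra.
From mathcomp Require Import sesquilinear.
From mathcomp Require Import all_classical all_reals all_analysis.

Set Implicit Arguments.
Unset Strict Implicit.
Unset Printing Implicit Defensive.

Import Order.TTheory GRing.Theory Num.Theory.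
Import numFieldNormedType.Exports.

Local Open Scope classical_set_scope.
Local Open Scope ring_scope.

Section Space.
Context {R : realType} (E : normedModType R).

(* A Euclidean space is a normed module whose norm comes from a positive
   definite symmetric form and which is linearly isomorphic to some 'rV[R]_n. *)
Definition finite_dimensional :=
  exists n : nat, exists2 v2r : E -> 'rV[R]_n, linear v2r & bijective v2r.

Definition norm_of_dot (dot : {dot E for idfun}) :=
  forall x : E, `|x| = Num.sqrt (dot x x).

End Space.

Section Semicontinuity.
Context {R : realType}.

Definition posR : set R := [set u | 0 < u].

(* Functions with values in R_++ extended by 0 and +oo are functions into
   \bar R that are nonnegative everywhere. *)
Definition nonneg_valued (T : Type) (f : T -> \bar R) :=
  forall x, (0 <= f x)%E.

Definition in_posR (a : \bar R) := (0 < a < +oo)%E.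

Definition epigraph (T : Type) (f : T -> \bar R) : set (T * R) :=
  [set p | 0 < p.2 /\ (f p.1 <= p.2%:E)%E].

Definition hypograph (T : Type) (f : T -> \bar R) : set (T * R) :=
  [set p | 0 < p.2 /\ (p.2%:E <= f p.1)%E].

(* Upper semicontinuity of f restricted to D; only the trace of [hypograph f] on
   D x R_++ matters for closedness in the subspace topology. *)
Definition usc_on (T : topologicalType) (D : set T) (f : T -> \bar R) :=
  closed (hypograph f : set (subspace (D `*` posR))).

End Semicontinuity.

Section Radial.
Context {R : realType} {E : normedModType R}.
Implicit Types (f : E -> \bar R) (y : E).

(* v |-> v * f (y / v), meaningful for v > 0 only *)
Definition perspective f y (v : R) : \bar R := (v%:E * f (v^-1 *: y))%E.

Definition upper_radial f :=
  forall y, usc_on posR (perspective f y) /\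
    (forall v w : R, 0 < v -> v <= w ->
       (perspective f y v <= perspective f y w)%E).

Definition strictly_upper_radial f :=
  upper_radial f /\
  (forall y (v w : R), 0 < v -> v < w ->
     in_posR (perspective f y v) -> in_posR (perspective f y w) ->
     (perspective f y v < perspective f y w)%E).

Definition radial_Gamma (p : E * R) : E * R := (p.2^-1 *: p.1, p.2^-1).

(* The element 0 implements sup of the empty set being 0 (it is -oo for
   [ereal_sup]); it is harmless otherwise since all the v are positive. *)
Definition radial_dual f y : \bar R :=
  ereal_sup (0%E |` [set v%:E | v in [set v | 0 < v /\ (radial_Gamma @` epigraph f) (y, v)]]).

Lemma radial_dualE f y :
  radial_dual f y =
  ereal_sup (0%E |`
    [set v%:E | v in [set v | 0 < v /\ (perspective f y v <= 1)%E]]).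
Proof.
rewrite /radial_dual; congr (ereal_sup (_ |` image _ _)).
apply/seteqP; split=> v /= [v0 H]; split=> //.
- case: H => -[x u] /= [u0 fu] [<- vE].
  have vu : v = u^-1 by rewrite -vE.
  rewrite /perspective vu invrK scalerA divff ?gt_eqF// scale1r.
  by rewrite lee_pdivrMl// mule1.
- exists (v^-1 *: y, v^-1); last first.
    by rewrite /radial_Gamma/= invrK scalerA divff ?gt_eqF// scale1r.
  rewrite /epigraph/= invr_gt0; split=> //.
  by rewrite -[leRHS]mule1 lee_pdivlMl.
Qed.

End Radial.

Section Proximal.
Context {R : realType} {E : normedModType R}.
Implicit Types (dot : {dot E for idfun}) (S : set (E * R)) (f : E -> \bar R).

(* Euclidean inner product and norm of E x R; the library norm of the product
   type is the max norm and is not used. *)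
Definition pdot dot (p q : E * R) : R := dot p.1 q.1 + p.2 * q.2.
Definition pnorm dot (p : E * R) : R := Num.sqrt (pdot dot p p).

Definition prox_normal dot S (p : E * R) : set (E * R) :=
  [set z | S p /\ exists2 e : R, 0 < e &
     forall q, S q -> pnorm dot (p + e *: z - p) <= pnorm dot (p + e *: z - q)].

Definition prox_sub dot f (x : E) : set E :=
  [set z | in_posR (f x) /\ prox_normal dot (epigraph f) (x, fine (f x)) (z, -1)].

Definition prox_sup dot f (x : E) : set E :=
  [set z | in_posR (f x) /\ prox_normal dot (hypograph f) (x, fine (f x)) (- z, 1)].

Definition dist0 (A : set E) : \bar R := ereal_inf [set `|z|%:E | z in A].

Definition radial_R dot f : \bar R :=
  ereal_inf [set `|x'|%:E | x' in [set x' : E | exists p z : E * R,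
    [/\ hypograph f p, z != 0, prox_normal dot (hypograph f) p z &
        pdot dot z ((x', 0) - p) = 0]]].

(* Differs from the library power only by 0 ^ 0 = 0. *)
Definition lpow (a : \bar R) (theta : R) : \bar R :=
  if a == 0%E then 0%E else poweR a theta.

Definition loj_max dot f (xs : E) (theta : R) :=
  exists r C : R, [/\ 0 < r, 0 < C & forall x, ball xs r x ->
    (f x <= f xs)%E /\
    (C%:E * lpow (f xs - f x) theta <= dist0 (prox_sup dot f x))%E].

Definition loj_min dot f (xs : E) (theta : R) :=
  exists r C : R, [/\ 0 < r, 0 < C & forall x, ball xs r x ->
    (f xs <= f x)%E /\
    (C%:E * lpow (f x - f xs) theta <= dist0 (prox_sub dot f x))%E].

End Proximal.

(* Main.v *)
Require Import Defs.
From HB Require Import structures.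
From mathcomp Require Import all_boot all_order all_algebra.
From mathcomp Require Import sesquilinear.
From mathcomp Require Import all_classical all_reals all_analysis.
From mathcomp Require Import ring lra.
Import Order.TTheory GRing.Theory Num.Theory.
Import numFieldNormedType.Exports.
Local Open Scope classical_set_scope.
Local Open Scope ring_scope.

(* Gamma is an involution carrying hypo f onto epi f^Gamma, and it is projective,
   so a proximal normal (z, d) to epi f^Gamma at (y, v) becomes the proximal
   normal (z, - (<z, y> + d v)) to hypo f at (y / v, 1 / v). Under this
   correspondence the hyperplane through (y / v, 1 / v) meets E x {0} at distance
   |d| / |z| from the origin, so R(f) > 0 bounds |z| / |d| and makes f^Gamma
   calm at ys: for y near ys the point (y / v, 1 / v), v = f^Gamma(y), is
   near (xs, f xs), where the Lojasiewicz condition on f applies.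
   For z in the subdifferential of f^Gamma at y, either <z, y> >= v / 2, and |z|
   is bounded below, or - z / (v - <z, y>) is a proximal supgradient of f at
   y / v, with v - <z, y> bounded below. *)

(** * Compactness in finite dimension *)

Lemma fin_dim_bounded_closed_compact (R : realType) (E : normedModType R)
    (A : set E) :
  finite_dimensional E -> bounded_set A -> closed A -> compact A.
Proof.
move=> [n [v2r v2rL [r2v v2rK r2vK]]] Abd Acl.
have r2vL : linear r2v.
  move=> a u v; apply: (can_inj v2rK).
  by rewrite r2vK v2rL !r2vK.
have [L LE] : exists L : {linear 'rV[R]_n -> E}, L =1 r2v.
  pose L0 : {linear 'rV[R]_n -> E} :=
    HB.pack r2v (GRing.isLinear.Build _ _ _ _ _ r2vL).
  by exists L0.
have Linj : injective L by move=> u v; rewrite !LE; exact: (can_inj r2vK).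
(* In the standard basis, [L] is a finite sum of coordinate functions times fixed vectors. *)
have Lc : continuous (L : 'rV[R]_n -> E).
  have -> : (L : 'rV[R]_n -> E) =
      (fun w => \sum_(j < n) w ord0 j *: L (delta_mx ord0 j)).
    apply/funext => w; rewrite {1}(row_sum_delta w) linear_sum.
    by apply: eq_bigr => j _; rewrite linearZ.
  have cadd : continuous (fun x : E * E => x.1 + x.2) by exact: add_continuous.
  move=> w; apply: (cvg_big cadd (nbhs_filter w)) => j _.
  by apply: cvgZr_tmp; exact: coord_continuous.
(* [L] is injective, so [|L w|] has a positive minimum on the compact unit sphere; by homogeneity
   [K] is the inverse of that minimum. Hence the preimage of a bounded set is bounded. If the sphere
   is empty, every vector is 0. *)
have [K Kb] : exists K : R, forall w : 'rV[R]_n, `|w| <= K * `|L w|.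
  pose S := [set w : 'rV[R]_n | `|w| = 1].
  have Sn (w : 'rV[R]_n) : w != 0 -> S (`|w|^-1 *: w).
    move=> w0; rewrite /S /= normrZ normfV normr_id mulVf// normr_eq0//.
  have [S0|S0] := pselect (S !=set0); last first.
    exists 0 => w; have [->|w0] := eqVneq w 0; first by rewrite normr0 mul0r.
    by exfalso; apply: S0; exists (`|w|^-1 *: w); exact: Sn.
  have Sc : compact S.
    apply: bounded_closed_compact.
      by exists 1; split=> // x x1 w /= ->; exact: ltW.
    have -> : S = (fun w => `|w|) @^-1` [set x | x = 1] by [].
    by apply: preimage_closed => [w _|]; [exact: norm_continuous|exact: closed_eq].
  have Lcn : {within S, continuous (fun w => `|L w|)}.
    apply: continuous_subspaceT => w.
    by apply: continuous_comp; [exact: Lc|exact: norm_continuous].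
  have [c cS cmin] := compact_EVT_min S0 Sc Lcn.
  have Lc0 : 0 < `|L c|.
    rewrite normr_gt0; apply/negP => /eqP Lc0.
    have c0 : c = 0 by apply: Linj; rewrite Lc0 linear0.
    by move: cS; rewrite inE /S /= c0 normr0 => /esym/eqP; rewrite oner_eq0.
  exists `|L c|^-1 => w; have [->|w0] := eqVneq w 0.
    by rewrite linear0 !normr0 mulr0.
  have := cmin (`|w|^-1 *: w); rewrite inE => /(_ (Sn _ w0)).
  rewrite linearZ normrZ normfV normr_id ler_pdivlMl ?normr_gt0//.
  by rewrite ler_pdivlMl// mulrC.
have -> : A = L @` (L @^-1` A).
  rewrite image_preimage//; apply/seteqP; split=> // x _.
  by exists (v2r x); rewrite ?LE ?v2rK.
apply: continuous_compact; first exact: continuous_subspaceT.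
apply: bounded_closed_compact; last exact: preimage_closed.
have [M [Mr Mb]] := Abd.
exists (`|K| * (`|M| + 1)); split=> [|x /ltW Mx w /= LwA]; first exact: num_real.
apply: (le_trans _ Mx).
apply: (le_trans (Kb w)); apply: (@le_trans _ _ (`|K| * `|L w|)).
  by rewrite ler_wpM2r ?ler_norm.
rewrite ler_wpM2l//.
have M1 : M < `|M| + 1 by rewrite (le_lt_trans (ler_norm M))// ltrDl.
exact: Mb M1 _ LwA.
Qed.

(** * Inner products on E and E x R, proximal normals and nearest points *)

Section DotProduct.
Context {R : realType} {E : normedModType R} (dot : {dot E for idfun}).

Lemma dotC x y : dot x y = dot y x.
Proof. by rewrite (hermC dot) expr0 mul1r. Qed.

Lemma dotDl x y z : dot (x + y) z = dot x z + dot y z.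
Proof. exact: linearDl. Qed.

Lemma dotDr x y z : dot z (x + y) = dot z x + dot z y.
Proof. exact: linearDr. Qed.

Lemma dotZl a x y : dot (a *: x) y = a * dot x y.
Proof. exact: linearZl_LR. Qed.

Lemma dotZr a x y : dot y (a *: x) = a * dot y x.
Proof. exact: linearZr_LR. Qed.

Lemma dotNl x y : dot (- x) y = - dot x y.
Proof. exact: linearNl. Qed.

Lemma dotNr x y : dot y (- x) = - dot y x.
Proof. exact: linearNr. Qed.

Lemma dot0l x : dot 0 x = 0.
Proof. by rewrite -(scale0r 0) dotZl mul0r. Qed.

Lemma dot_ge0 x : 0 <= dot x x.
Proof.
by have [->|/neq0_dnorm_gt0/ltW] := eqVneq x 0; first by rewrite dot0l.
Qed.

Hypothesis dotE : norm_of_dot dot.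

Lemma dotxx x : dot x x = `|x| ^+ 2.
Proof. by rewrite dotE sqr_sqrtr// dot_ge0. Qed.

Lemma dot_le_norm x y : dot x y <= `|x| * `|y|.
Proof.
have [->|x0] := eqVneq x 0; first by rewrite dot0l normr0 mul0r.
have [->|y0] := eqVneq y 0; first by rewrite dotC dot0l normr0 mulr0.
have xy0 : 0 < `|x| * `|y| by rewrite mulr_gt0 ?normr_gt0.
(* Expanding this square gives twice the Cauchy-Schwarz inequality multiplied by [|x| * |y|]. *)
have := dot_ge0 (`|y| *: x - `|x| *: y).
rewrite !(dotDl, dotDr, dotNl, dotNr, dotZl, dotZr) !dotxx (dotC y x) => h.
rewrite -(ler_pM2l xy0); nra.
Qed.

Implicit Types (p q z : E * R).

Lemma pdotC p q : pdot dot p q = pdot dot q p.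
Proof. by rewrite /pdot dotC mulrC. Qed.

Lemma pdotDl p q z : pdot dot (p + q) z = pdot dot p z + pdot dot q z.
Proof. by rewrite /pdot /= dotDl; ring. Qed.

Lemma pdotDr p q z : pdot dot z (p + q) = pdot dot z p + pdot dot z q.
Proof. by rewrite !(pdotC z) pdotDl. Qed.

Lemma pdotNl p q : pdot dot (- p) q = - pdot dot p q.
Proof. by rewrite /pdot /= dotNl; ring. Qed.

Lemma pdotNr p q : pdot dot q (- p) = - pdot dot q p.
Proof. by rewrite !(pdotC q) pdotNl. Qed.

Lemma pdotZl a p q : pdot dot (a *: p) q = a * pdot dot p q.
Proof. by rewrite /pdot /= dotZl mulrDr mulrA. Qed.

Lemma pdotZr a p q : pdot dot q (a *: p) = a * pdot dot q p.
Proof. by rewrite !(pdotC q) pdotZl. Qed.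

Lemma pdot_ge0 p : 0 <= pdot dot p p.
Proof. by rewrite addr_ge0 ?dot_ge0// -expr2 sqr_ge0. Qed.

Lemma pdot_le0 p : (pdot dot p p <= 0) -> p = 0.
Proof.
case: p => x u; rewrite /pdot /= dotxx -expr2 => h.
have x0 : `|x| ^+ 2 = 0 by apply/eqP; rewrite eq_le sqr_ge0 andbT; nra.
have u0 : u ^+ 2 = 0 by apply/eqP; rewrite eq_le sqr_ge0 andbT; nra.
by move: x0 u0 => /eqP; rewrite sqrf_eq0 normr_eq0 => /eqP -> /eqP; rewrite sqrf_eq0 => /eqP ->.
Qed.

Lemma ler_pnorm p q :
  (pnorm dot p <= pnorm dot q) = (pdot dot p p <= pdot dot q q).
Proof. by rewrite ler_psqrt// nnegrE pdot_ge0. Qed.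

(** Expanding both squared distances cancels the term [e ^+ 2 * |z| ^+ 2] and leaves a quadratic
    bound on a linear form, with [s] equal to 1 / (2 e). This form makes rescaling [z] and changing
    variables easy. *)
Lemma prox_normalP (S : set (E * R)) p z : prox_normal dot S p z <->
  S p /\ exists2 s : R, 0 < s &
    forall q, S q -> pdot dot z (q - p) <= s * pdot dot (q - p) (q - p).
Proof.
have key e q : 0 < e ->
    (pnorm dot (p + e *: z - p) <= pnorm dot (p + e *: z - q)) =
    (pdot dot z (q - p) <= (2 * e)^-1 * pdot dot (q - p) (q - p)).
  move=> e0; rewrite ler_pnorm.
  have -> : p + e *: z - p = e *: z by rewrite addrAC subrr add0r.
  have -> : p + e *: z - q = e *: z - (q - p) by rewrite opprB addrCA addrA.
  move: (q - p) => w; rewrite ler_pdivlMl ?mulr_gt0//.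
  rewrite !(pdotDl, pdotDr, pdotNl, pdotNr, pdotZl, pdotZr) (pdotC w z).
  by apply/idP/idP; lra.
split=> -[Sp [s s0 H]]; split=> //.
  exists (2 * s)^-1; first by rewrite invr_gt0 mulr_gt0.
  by move=> q /H; rewrite key.
exists (2 * s)^-1; first by rewrite invr_gt0 mulr_gt0.
move=> q /H; rewrite key ?invr_gt0 ?mulr_gt0//.
by rewrite invfM invrK mulrA mulVf ?mul1r// pnatr_eq0.
Qed.

(** Only points at distance at most [r] from [p] compete with [q0]; they lie in the product of a
    closed ball and a segment, which is compact, so the continuous squared distance attains its
    minimum there. *)
Lemma nearest_point (S : set (E * R)) p : finite_dimensional E -> closed S ->
  S !=set0 -> exists2 s, S s &
    forall q, S q -> pdot dot (p - s) (p - s) <= pdot dot (p - q) (p - q).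
Proof.
move=> finE clS [q0 Sq0].
pose r := pnorm dot (p - q0).
have r0 : 0 <= r by rewrite sqrtr_ge0.
have r2 : r ^+ 2 = pdot dot (p - q0) (p - q0) by rewrite sqr_sqrtr ?pdot_ge0.
pose K := [set x : E | `|p.1 - x| <= r] `*` `[p.2 - r, p.2 + r].
have Kc : compact K.
  apply: compact_setX; last exact: segment_compact.
  apply: fin_dim_bounded_closed_compact finE _ _; last exact: closed_closed_ball_.
  exists (`|p.1| + r); split=> [|x Mx y /= yr]; first exact: num_real.
  apply: le_trans (ltW Mx); rewrite -lerBlDl; apply: le_trans yr.
  by rewrite distrC lerB_dist.
have inK q : pdot dot (p - q) (p - q) <= r ^+ 2 -> K q.
  move=> h; have {h} : `|p.1 - q.1| ^+ 2 + (p.2 - q.2) ^+ 2 <= r ^+ 2.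
    by rewrite -dotxx expr2.
  move=> h; split=> /=.
    by rewrite -ler_sqr ?nnegrE//; have := sqr_ge0 (p.2 - q.2); lra.
  have : `|p.2 - q.2| <= r.
    rewrite -ler_sqr ?nnegrE// real_normK ?num_real//.
    by have := sqr_ge0 `|p.1 - q.1|; lra.
  by rewrite ler_norml in_itv /= => /andP[? ?]; apply/andP; split; lra.
have KS0 : (K `&` S) !=set0 by exists q0; split=> //; apply: inK; rewrite r2.
have KSc : compact (K `&` S) by exact: compact_closedI.
pose D q := `|p.1 - q.1| * `|p.1 - q.1| + (p.2 - q.2) * (p.2 - q.2).
have cD : {within K `&` S, continuous D}.
  apply: continuous_subspaceT => q.
  have c1 : (`|p.1 - x.1|) @[x --> q] --> `|p.1 - q.1|.
    by apply: cvg_norm; apply: cvgB; [exact: cvg_cst|exact: cvg_fst].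
  have c2 : (p.2 - x.2) @[x --> q] --> p.2 - q.2.
    by apply: cvgB; [exact: cvg_cst|exact: cvg_snd].
  by apply: cvgD; exact: cvgM.
have DE q : pdot dot (p - q) (p - q) = D q by rewrite /pdot dotxx expr2.
have [s] := compact_EVT_min KS0 KSc cD.
rewrite inE => -[Ks Ss] smin; exists s => // q Sq.
have [qr|qr] := lerP (pdot dot (p - q) (p - q)) (r ^+ 2).
  by rewrite !DE; apply: smin; rewrite inE; split=> //; exact: inK.
rewrite (le_trans _ (ltW qr))// r2 !DE; apply: smin; rewrite inE; split=> //.
by apply: inK; rewrite r2.
Qed.

End DotProduct.

(** Divide by [t] and let [t] tend to 0; the single value min(t0, a / (2 c)) already yields a <= a /
    2. This extracts the sign of the vertical component of a normal along a vertical segment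
    contained in the set. *)
Lemma le0_of_mul_le_sqr (R : realType) (a c t0 : R) : 0 < c -> 0 < t0 ->
  (forall t, 0 < t <= t0 -> a * t <= c * t ^+ 2) -> a <= 0.
Proof.
move=> c0 t00 H; rewrite leNgt; apply/negP => a0.
pose t := Num.min t0 (a / (2 * c)).
have t_gt0 : 0 < t by rewrite lt_min t00 divr_gt0// mulr_gt0.
have := H t; rewrite t_gt0 {1}/t ge_min lexx => /(_ isT).
rewrite expr2 mulrA ler_pM2r// => h.
have : c * t <= c * (a / (2 * c)) by rewrite (ler_wpM2l (ltW c0))// /t ge_min lexx orbT.
have -> : c * (a / (2 * c)) = a / 2 by field; rewrite gt_eqF.
lra.
Qed.

(** * Cones contained in a set with controlled normals, and normals under Gamma *)

Section Geometry.
Context {R : realType} {E : normedModType R} (dot : {dot E for idfun}).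
Hypothesis dotE : norm_of_dot dot.

(* The squared distance to S grows by at most t^2 |d|^2 along a step t d,
   because the normal at the nearest point makes an obtuse angle with d; letting
   the number of steps grow shows that S is never left. *)
Lemma cone_sub (S : set (E * R)) (L : R) (x0 x : E) (u0 u : R) :
  finite_dimensional E -> closed S ->
  (forall y v w, S (y, v) -> v <= w -> S (y, w)) ->
  (forall p z, prox_normal dot S p z -> `|z.1| <= L * `|z.2|) ->
  S (x0, u0) -> L * `|x - x0| <= u - u0 -> S (x, u).
Proof.
move=> finE clS upS normS S0 cone.
have SS0 : S !=set0 by exists (x0, u0).
pose d : E * R := (x - x0, u - u0).
pose near_S p D := exists2 s, S s & pdot dot (p - s) (p - s) <= D.
have step p D t : 0 <= t -> near_S p D ->
    near_S (p + t *: d) (D + t ^+ 2 * pdot dot d d).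
  move=> t0 [s0 Ss0 sD0].
  have [s Ss smin] := nearest_point dot dotE S p finE clS SS0.
  have {s0 Ss0 sD0} sD := le_trans (smin _ Ss0) sD0.
  pose n := p - s.
  have nS : prox_normal dot S s n.
    split=> //; exists 1 => // q Sq.
    have -> : s + 1 *: n - s = p - s by rewrite scale1r addrAC subrr add0r.
    have -> : s + 1 *: n - q = p - q by rewrite scale1r [s + _]addrC subrK.
    by rewrite ler_pnorm//; exact: smin.
  (* Testing the normal against the points of [S] straight above [s] shows that it cannot point
     upwards. *)
  have n2 : n.2 <= 0.
    have [_ [c c0 Hc]] := (prox_normalP dot _ _ _).1 nS.
    apply: (@le0_of_mul_le_sqr _ _ c 1) => // e /andP[e0 _].
    have Sq : S (s.1, s.2 + e) by apply: (upS _ s.2); [case: (s) Ss|lra].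
    have := Hc _ Sq; rewrite /pdot/= subrr dot0l dotC dot0l !add0r.
    by rewrite addrAC subrr add0r -expr2.
  (* With -n.2 >= 0, the slope bound on [n] and the cone condition on [d] make the horizontal part
     of the product at most -n.2 (u - u0), which the vertical part cancels. *)
  have nd : pdot dot n d <= 0.
    have := normS _ _ nS; rewrite (ler0_norm n2) => n1.
    rewrite /pdot; have := dot_le_norm dot dotE n.1 d.1.
    have : `|n.1| * `|d.1| <= L * - n.2 * `|d.1| by rewrite ler_wpM2r.
    have : - n.2 * (L * `|x - x0|) <= - n.2 * (u - u0).
      by rewrite ler_wpM2l// oppr_ge0.
    rewrite /d /=; nra.
  exists s => //.
  have -> : p + t *: d - s = n + t *: d by rewrite addrAC.
  have {sD} : pdot dot n n <= D by [].
  clearbody n.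
  rewrite !(pdotDl, pdotDr, pdotZl, pdotZr) (pdotC dot d n).
  have : t * pdot dot n d <= 0 by rewrite mulr_ge0_le0.
  by nra.
have steps t k : 0 <= t ->
    near_S ((x0, u0) + (k%:R * t) *: d) (k%:R * (t ^+ 2 * pdot dot d d)).
  move=> t0; elim: k => [|k IH].
    by exists (x0, u0) => //; rewrite !mul0r scale0r addr0 subrr /pdot /= dot0l mulr0 addr0.
  have kE (r : R) : k.+1%:R * r = k%:R * r + r by rewrite -natr1 mulrDl mul1r.
  by have := step _ _ _ t0 IH; rewrite -addrA -scalerDl -!kE.
have [s Ss smin] := nearest_point dot dotE S (x, u) finE clS SS0.
suff /(pdot_le0 dot dotE) h : pdot dot ((x, u) - s) ((x, u) - s) <= 0.
  by move/eqP: h; rewrite subr_eq0 => /eqP ->.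
rewrite leNgt; apply/negP => D0.
set D := pdot _ _ _ in D0 smin.
(* After m + 1 steps of size 1 / (m + 1) the walk is at [(x, u)] with squared distance to [S] at
   most |d|^2 / (m + 1), which this [m] makes smaller than [D]. *)
have [m mD] : exists m : nat, pdot dot d d / D < m.+1%:R.
  exists (Num.truncn (pdot dot d d / D)); exact: truncnS_gt.
have m0 : 0 <= m.+1%:R^-1 :> R by rewrite invr_ge0.
have [s1 Ss1] := steps _ m.+1 m0.
rewrite mulfV ?pnatr_eq0// scale1r.
have -> : (x0, u0) + d = (x, u) by congr pair; rewrite /= addrC subrK.
have -> : m.+1%:R * (m.+1%:R^-1 ^+ 2 * pdot dot d d) = m.+1%:R^-1 * pdot dot d d.
  by rewrite expr2 !mulrA mulfV ?pnatr_eq0// mul1r.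
move=> s1D; have := le_trans (smin _ Ss1) s1D.
by rewrite ler_pdivlMl// leNgt -ltr_pdivrMr// mD.
Qed.

Lemma radial_GammaK (p : E * R) : 0 < p.2 -> radial_Gamma (radial_Gamma p) = p.
Proof.
case: p => x u /= u0.
by rewrite /radial_Gamma /= invrK scalerA divff ?gt_eqF// scale1r.
Qed.

(* For (x, u) = Gamma (y, v) and (x', u') = Gamma (y', v') one has
   u' <(z, d), (y' - y, v' - v)> = <(z, - (<z, y> + d v)), (x' - x, u' - u)>,
   and Gamma is Lipschitz on u' >= u / 2. *)
Lemma prox_normal_radial (H : set (E * R)) (y z : E) (v d : R) :
  (forall p, H p -> 0 < p.2) ->
  prox_normal dot [set q | 0 < q.2 /\ H (radial_Gamma q)] (y, v) (z, d) ->
  prox_normal dot H (radial_Gamma (y, v)) (z, - (dot z y + d * v)).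
Proof.
move=> H0 /(prox_normalP dot)[[/= v0 Hyv] [s s0 Hs]].
apply/(prox_normalP dot); split=> //.
set d' := - (dot z y + d * v).
pose K := 2 + 2 * `|y| ^+ 2 + v ^+ 2.
have K0 : 0 < K by rewrite /K; nra.
pose N := `|z| ^+ 2 + d' ^+ 2.
have N0 : 0 <= N by rewrite addr_ge0 ?sqr_ge0.
(* The first term serves when u' >= 1 / (2 v), the others when u' < 1 / (2 v). *)
exists (2 * s * K * v + 2 * N * v ^+ 2 + 1).
  have : 0 <= 2 * s * K * v by rewrite !mulr_ge0 ?(ltW s0) ?(ltW K0) ?(ltW v0).
  have : 0 <= 2 * N * v ^+ 2 by rewrite mulr_ge0 ?sqr_ge0 ?mulr_ge0.
  lra.
(* Since |a - b y|^2 <= 2 |a|^2 + 2 b^2 |y|^2, [K] controls the displacement of Gamma, up to the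
   factor 1 / u'. *)
have sq (a : E) (b : R) :
    `|a - b *: y| ^+ 2 + (b * v) ^+ 2 <= K * (`|a| ^+ 2 + b ^+ 2).
  have := sqr_ge0 `|a + b *: y|.
  rewrite /K -!(dotxx dot dotE).
  rewrite !(dotDl, dotDr, dotNl, dotNr, dotZl, dotZr) (dotC dot y a).
  have : 0 <= dot a a * v ^+ 2 by rewrite mulr_ge0 ?dot_ge0 ?sqr_ge0.
  have : 0 <= dot a a * dot y y by rewrite mulr_ge0 ?dot_ge0.
  nra.
move=> [x' u'] Hq; have /= u'0 := H0 _ Hq.
pose a := x' - v^-1 *: y; pose b := u' - v^-1.
have -> : (x', u') - radial_Gamma (y, v) = (a, b) by [].
rewrite /pdot /= !(dotxx dot dotE) -expr2.
have gE : radial_Gamma (x', u') - (y, v) = (u'^-1 *: (a - b *: y), u'^-1 * (- b * v)).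
  congr pair; rewrite /a /b /=.
    rewrite scalerBl opprB addrA subrK scalerBr scalerA mulVf ?gt_eqF//.
    by rewrite scale1r.
  by field; rewrite !gt_eqF.
have := Hs (radial_Gamma (x', u')); rewrite radial_GammaK//= invr_gt0 u'0.
move=> /(_ (conj isT Hq)); rewrite gE /pdot /=.
rewrite !(dotZl, dotZr) (dotDr _ a) dotNr dotZr => main.
(* Multiplying by u' makes the left side the pairing with the new normal and leaves a single factor
   1 / u' on the right. *)
have {}main : dot z a + d' * b <= s * u'^-1 * (`|a - b *: y| ^+ 2 + (b * v) ^+ 2).
  move: main; rewrite -!(dotxx dot dotE) => /(ler_wpM2l (ltW u'0)) main.
  set W := dot (a - b *: y) (a - b *: y) in main *.
  have -> : s * u'^-1 * (W + (b * v) ^+ 2) = u' * (s * (u'^-1 * (u'^-1 * W) +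
      u'^-1 * (- b * v) * (u'^-1 * (- b * v)))) by field; rewrite gt_eqF.
  apply: le_trans main; rewrite /d' le_eqVlt; apply/orP; left; apply/eqP.
  by field; rewrite gt_eqF.
have {}sq := sq a b.
have a2 := sqr_ge0 `|a|; have b2 := sqr_ge0 b.
set w := `|a| ^+ 2 + b ^+ 2 in sq *.
have w0 : 0 <= w by rewrite addr_ge0.
have svw : 0 <= s * v * (K * w) by rewrite !mulr_ge0// ltW.
have Nvw : 0 <= N * v ^+ 2 * w by exact: mulr_ge0 (mulr_ge0 N0 (sqr_ge0 v)) w0.
have [uu|uu] := lerP v^-1 (2 * u').
  have u'v : u'^-1 <= 2 * v.
    rewrite -(invrK v) ler_pdivlMr ?invr_gt0// mulrC ler_pdivrMr// .
  have : s * u'^-1 * (K * w) <= s * (2 * v) * (K * w).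
    by rewrite ler_wpM2r ?mulr_ge0 ?ler_wpM2l// ltW.
  have : s * u'^-1 * (`|a - b *: y| ^+ 2 + (b * v) ^+ 2) <= s * u'^-1 * (K * w).
    by rewrite ler_wpM2l// mulr_ge0 ?invr_ge0// ltW.
  nra.
(* Far from the base point no Lipschitz bound on Gamma is needed: |b| exceeds 1 / (2 v), so [N] is
   at most 4 N v^2 w, and the pairing is at most (N + w) / 2. *)
have bv : 1 <= 4 * (b ^+ 2 * v ^+ 2).
  have : b * v <= - 2^-1.
    have : v^-1 * v = 1 by rewrite mulVf ?gt_eqF.
    have : 2 * u' * v < v^-1 * v by rewrite ltr_pM2r.
    rewrite /b; lra.
  rewrite -exprMn; nra.
have : N * 1 <= N * (4 * (b ^+ 2 * v ^+ 2)) by rewrite ler_wpM2l.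
have : N * v ^+ 2 * b ^+ 2 <= N * v ^+ 2 * w.
  by apply: ler_wpM2l; [exact: mulr_ge0 N0 (sqr_ge0 v)|rewrite /w lerDr].
have := dot_le_norm dot dotE z a.
have := sqr_ge0 (`|z| - `|a|); have := sqr_ge0 (d' - b).
rewrite /N /w in svw w0 *; nra.
Qed.
End Geometry.

(** * The epigraph of the radial dual and its normals *)

Section RadialDual.
Context {R : realType} {E : normedModType R} (dot : {dot E for idfun}).
Hypothesis dotE : norm_of_dot dot.
Variable f : E -> \bar R.
Hypothesis f_usc : usc_on setT f.

(** Gamma is its own inverse, so the image Gamma(hypo f) can be written as a preimage, which suits
    proofs of closedness. *)
Definition radial_hypograph : set (E * R) :=
  [set q | 0 < q.2 /\ hypograph f (radial_Gamma q)].

Variable M : R.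
Hypothesis M_gt0 : 0 < M.
Hypothesis f_le : forall x, (f x <= M%:E)%E.

Lemma radial_hypograph_ge (q : E * R) : radial_hypograph q -> M^-1 <= q.2.
Proof.
move=> [q0 [_ /= /le_trans/(_ (f_le _))]].
by rewrite lee_fin => h; rewrite -[leRHS]invrK lef_pV2// posrE invr_gt0.
Qed.

(* Gamma is continuous only off q.2 = 0, hence the truncation at 1 / M *)
Lemma closed_radial_hypograph : closed radial_hypograph.
Proof.
have [V Vcl VH] := (closed_subspaceP _ _).1 f_usc.
pose T (q : E * R) := radial_Gamma (q.1, Num.max q.2 M^-1).
have M'0 : 0 < M^-1 by rewrite invr_gt0.
have Tc : continuous T.
  move=> q; have mc : Num.max x.2 M^-1 @[x --> q] --> Num.max q.2 M^-1.
    by apply: (@continuous_max _ _ snd (cst M^-1)); [exact: cvg_snd|exact: cvg_cst].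
  have mV : (Num.max x.2 M^-1)^-1 @[x --> q] --> (Num.max q.2 M^-1)^-1.
    by apply: cvgV => //; rewrite gt_eqF// lt_max M'0 orbT.
  have zc : (Num.max x.2 M^-1)^-1 *: x.1 @[x --> q] --> (Num.max q.2 M^-1)^-1 *: q.1.
    by apply: cvgZ mV _; exact: cvg_fst.
  exact: cvg_pair zc mV.
have -> : radial_hypograph = [set q | M^-1 <= q.2] `&` T @^-1` V.
  apply/seteqP; split=> [[y v]|[y v] [/= Mv]].
    move=> h; have /= Mv := radial_hypograph_ge _ h; split=> //.
    case: h => /= v0 h; rewrite /T /= max_l//.
    have : (hypograph f `&` (setT `*` posR)) (radial_Gamma (y, v)).
      by split=> //; split=> //=; rewrite /posR /= invr_gt0.
    by rewrite -VH => -[].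
  rewrite /T /= max_l// => h; have v0 : 0 < v by exact: lt_le_trans Mv.
  split=> //.
  have : (V `&` (setT `*` posR)) (radial_Gamma (y, v)).
    by split=> //; split=> //=; rewrite /posR /= invr_gt0.
  by rewrite VH => -[].
apply: closedI; last by apply: preimage_closed => // q _; exact: Tc.
have -> : [set q : E * R | M^-1 <= q.2] = snd @^-1` [set x | M^-1 <= x] by [].
by apply: preimage_closed => [q _|]; [exact: cvg_snd|exact: closed_ge].
Qed.

Lemma perspective_ge1 y (v : R) : 0 < v ->
  (1 <= perspective f y v)%E = ((v^-1)%:E <= f (v^-1 *: y))%E.
Proof. by move=> v0; rewrite -[in RHS](mule1 (v^-1)%:E) lee_pdivrMl. Qed.

Lemma radial_hypographE y (v : R) : 0 < v ->
  radial_hypograph (y, v) <-> (1 <= perspective f y v)%E.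
Proof.
move=> v0; rewrite perspective_ge1//; split=> [[_ []]//|h].
by split=> //; split; rewrite /= ?invr_gt0.
Qed.

Hypothesis f_rad : strictly_upper_radial f.

(** If the perspective is at least 1 at v, strict monotonicity forbids a value at most 1 at any w >
    v, so v bounds the supremum. Conversely, if v bounds the supremum, the perspective exceeds 1 at
    every w > v, and closedness passes this to the limit as w decreases to v. *)
Lemma epigraph_radial_dual : epigraph (radial_dual f) = radial_hypograph.
Proof.
have [f_ur f_str] := f_rad.
have persp_fin y (v : R) : 0 < v -> (perspective f y v < +oo)%E.
  move=> v0; apply: (@le_lt_trans _ _ (v%:E * M%:E)%E); last by rewrite -EFinM ltry.
  by rewrite lee_pmul2l ?lte_fin.
apply/seteqP; split=> -[y v]; last first.
  move=> [/= v0 h]; have {h} pv : (1 <= perspective f y v)%E.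
    by apply/radial_hypographE.
  split=> //=; rewrite radial_dualE; apply: ge_ereal_sup => _ /= [->|[w [w0 pw] <-]].
    by rewrite lee_fin ltW.
  rewrite lee_fin leNgt; apply/negP => vw.
  have pvw := (f_ur y).2 v w v0 (ltW vw).
  have := f_str y v w v0 vw; rewrite /in_posR !persp_fin// !andbT.
  rewrite (lt_le_trans _ pv) ?lte01// (lt_le_trans _ (le_trans pv pvw)) ?lte01//.
  by move=> /(_ isT isT); rewrite ltNge (le_trans pw pv).
move=> [/= v0]; rewrite radial_dualE => dv.
have Hw w : v < w -> radial_hypograph (y, w).
  move=> vw; have w0 := lt_trans v0 vw; apply/(radial_hypographE _ _ w0).
  rewrite leNgt; apply/negP => pw.
  have : (w%:E <= v%:E)%E.
    by apply: le_trans dv; apply: ereal_sup_ubound; right; exists w => //; split=> //; exact: ltW.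
  by rewrite lee_fin leNgt vw.
have near_v : \forall w \near v^'+, radial_hypograph (y, w).
  by near=> w; apply: Hw; near: w; exact: nbhs_right_gt.
have cv : (y, w) @[w --> v^'+] --> (y, v).
  have cw : w @[w --> v^'+] --> v by apply: cvg_at_right_filter; exact: cvg_id.
  have cy : y @[w --> v^'+] --> y by exact: cvg_cst.
  exact: cvg_pair cy cw.
exact: (closed_cvg _ closed_radial_hypograph near_v _ cv).
Unshelve. all: by end_near. Qed.

Lemma prox_normal_radial_dual y v z d :
  prox_normal dot (epigraph (radial_dual f)) (y, v) (z, d) ->
  prox_normal dot (hypograph f) (v^-1 *: y, v^-1) (z, - (dot z y + d * v)).
Proof.
by rewrite epigraph_radial_dual; apply: (prox_normal_radial dot dotE) => p [].
Qed.

(* A normal (z, d) to the epigraph of the dual corresponds to a hyperplane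
   meeting E x {0} at distance |d| / |z| from the origin. *)
Lemma prox_normal_radial_dual_le : (0 < radial_R dot f)%E ->
  exists2 L : R, 0 < L & forall p z,
    prox_normal dot (epigraph (radial_dual f)) p z -> `|z.1| <= L * `|z.2|.
Proof.
move=> R_gt0.
have [r r0 rR] : exists2 r : R, 0 < r & (r%:E <= radial_R dot f)%E.
  move: R_gt0; case: (radial_R dot f) => [r r0|_|//]; first by exists r.
  by exists 1 => //; rewrite leey.
exists r^-1; first by rewrite invr_gt0.
move=> [y v] [z d] nz; have [[/= v0 _] _] := nz.
move/prox_normal_radial_dual in nz => /=.
have [->|z0] := eqVneq z 0; first by rewrite normr0 mulr_ge0// invr_ge0 ltW.
have z2 : 0 < `|z| by rewrite normr_gt0.
rewrite ler_pdivlMl// -ler_pdivlMr//.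
(* Intersected with E x {0}, the hyperplane reads <z, x'> = -d; this is its point nearest to the
   origin. *)
pose x' := (- d / `|z| ^+ 2) *: z.
have -> : `|d| / `|z| = `|x'|.
  rewrite normrZ normrM normrN normfV normrX normr_id.
  by field; rewrite gt_eqF.
rewrite -lee_fin; apply: le_trans rR _; apply: ereal_inf_lbound; exists x' => //.
exists (v^-1 *: y, v^-1), (z, - (dot z y + d * v)); split=> //.
- by case: nz.
- by apply: contra z0 => /eqP[->].
rewrite /pdot /= dotDr dotNr !dotZr (dotxx dot dotE).
by field; rewrite !gt_eqF.
Qed.

End RadialDual.

(** * Scaling of normals, normals with a positive vertical component, and upward closure of
    epigraphs *)

Lemma prox_normalZ (R : realType) (E : normedModType R) (dot : {dot E for idfun})
    (S : set (E * R)) (p z : E * R) (a : R) :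
  0 < a -> prox_normal dot S p z -> prox_normal dot S p (a *: z).
Proof.
move=> a0 /prox_normalP[Sp [s s0 H]]; apply/prox_normalP; split=> //.
exists (a * s); first exact: mulr_gt0.
by move=> q Sq; rewrite pdotZl -mulrA ler_pM2l//; exact: H.
Qed.

(** Strictly below the graph, a vertical segment above the point stays in the hypograph and forces d
    <= 0. *)
Lemma prox_normal_hypograph (R : realType) (E : normedModType R)
    (dot : {dot E for idfun}) (f : E -> \bar R) (x z : E) (u d : R) :
  (f x < +oo)%E -> 0 < d -> prox_normal dot (hypograph f) (x, u) (z, d) ->
  f x = u%:E.
Proof.
move=> fx d0 /prox_normalP[[/= u0 ux] [s s0 H]].
have fxE : f x = (fine (f x))%:E.
  by rewrite fineK// ge0_fin_numE// (le_trans _ ux)// lee_fin ltW.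
apply/eqP; rewrite eq_le ux andbT leNgt; apply/negP; rewrite fxE lte_fin => ufx.
suff : d <= 0 by rewrite leNgt d0.
apply: (@le0_of_mul_le_sqr _ _ s (fine (f x) - u)) => //; first by rewrite subr_gt0.
move=> t /andP[t0 tx]; have := H (x, u + t).
have -> : (x, u + t) - (x, u) = (0, t).
  by congr pair; rewrite /= ?subrr// addrAC subrr add0r.
rewrite /pdot /= dotC !dot0l !add0r -expr2; apply.
by split=> /=; [lra|rewrite fxE lee_fin; lra].
Qed.

Lemma radial_dual_ge0 (R : realType) (E : normedModType R) (f : E -> \bar R) y :
  (0 <= radial_dual f y)%E.
Proof. by apply: ereal_sup_ubound; left. Qed.

Lemma epigraph_up (R : realType) (T : Type) (g : T -> \bar R) y (v w : R) :
  epigraph g (y, v) -> v <= w -> epigraph g (y, w).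
Proof.
move=> [/= v0 gv] vw; split=> /=; first exact: lt_le_trans vw.
by rewrite (le_trans gv)// lee_fin.
Qed.

(** * Calmness, local minimality and transfer of the Łojasiewicz inequality *)

Theorem proposition3 (R : realType) (E : normedModType R)
    (dot : {dot E for idfun}) (dotE : norm_of_dot dot)
    (finE : finite_dimensional E)
    (f : E -> \bar R) (f_ge0 : nonneg_valued f)
    (f_usc : usc_on setT f) (f_rad : strictly_upper_radial f)
    (Rf_gt0 : (0 < radial_R dot f)%E)
    (sup_f : in_posR (ereal_sup (range f)))
    (xs ys : E) (us vs : R) (us_gt0 : 0 < us)
    (f_xs : f xs = us%:E) (fG_ys : radial_dual f ys = vs%:E)
    (ysE : (ys, vs) = radial_Gamma (xs, us))
    (theta : R) (theta01 : 0 <= theta < 1)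
    (xs_max : loj_max dot f xs theta) :
  loj_min dot (radial_dual f) ys theta.
Proof.
have [M M_gt0 f_le] : exists2 M : R, 0 < M & forall x, (f x <= M%:E)%E.
  have /andP[s0 s1] := sup_f.
  have sE : (fine (ereal_sup (range f)))%:E = ereal_sup (range f).
    by rewrite fineK// ge0_fin_numE// ltW.
  exists (fine (ereal_sup (range f))) => [|x]; first by rewrite -lte_fin sE.
  by rewrite sE; apply: ereal_sup_ubound; exists x.
have f_lty x : (f x < +oo)%E by apply: le_lt_trans (f_le x) _; exact: ltry.
set g := radial_dual f in fG_ys *.
have epi_g : epigraph g = radial_hypograph f.
  exact: (epigraph_radial_dual f f_usc M M_gt0 f_le f_rad).
have vsE : vs = us^-1 by case: ysE.
have usE : us = vs^-1 by rewrite vsE invrK.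
have vs_gt0 : 0 < vs by rewrite vsE invr_gt0.
have xsE : vs^-1 *: ys = xs.
  by case: ysE => -> _; rewrite vsE invrK scalerA mulfV ?gt_eqF// scale1r.
have [r [C [r_gt0 C_gt0 xs_loj]]] := xs_max.
(* Continuity of Gamma at [(ys, vs)]. The cap at 1 gives |y| <= |ys| + 1, v <= vs + 1 and (v -
   vs)^theta <= 1 later. *)
have [e /andP[e_gt0 e_le1] e_ball] : exists2 e : R, 0 < e <= 1 &
    forall y v, `|y - ys| < e -> `|v - vs| < e -> ball xs r (v^-1 *: y).
  have sc : q.2^-1 *: q.1 @[q --> (ys, vs)] --> vs^-1 *: ys.
    apply: cvgZ; last exact: cvg_fst.
    by apply: cvgV; [rewrite gt_eqF|exact: cvg_snd].
  have /sc : nbhs (vs^-1 *: ys) (ball xs r) by rewrite xsE; exact: nbhsx_ballx.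
  move=> /nbhs_ballP[e /= e0 eb]; exists (Num.min e 1).
    by rewrite lt_min e0 ltr01 ge_min lexx orbT.
  move=> y v; rewrite !lt_min => /andP[ye _] /andP[ve _].
  by apply: (eb (y, v)); split; rewrite -ball_normE /= distrC.
have [L L_gt0 normL] := prox_normal_radial_dual_le dot dotE f f_usc M M_gt0 f_le f_rad Rf_gt0.
have g_cone y : (g y <= (vs + L * `|y - ys|)%:E)%E.
  have : epigraph g (y, vs + L * `|y - ys|).
    apply: (cone_sub dot dotE _ L ys y vs _ finE) => //.
    - by rewrite epi_g; exact: (closed_radial_hypograph f f_usc M M_gt0 f_le).
    - exact: epigraph_up.
    - by split=> //=; rewrite fG_ys.
    - by rewrite addrAC subrr add0r.
  by case.
(* The second bound combines with calmness: v = g y then exceeds [vs] by less than [e]. *)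
pose r' := Num.min e (e / L).
have r'_gt0 : 0 < r' by rewrite lt_min e_gt0 divr_gt0.
have ball_r' y : ball ys r' y -> `|y - ys| < e /\ L * `|y - ys| < e.
  rewrite -ball_normE /= distrC lt_min => /andP[-> h]; split=> //.
  by rewrite mulrC -ltr_pdivlMr.
have g_ge y : ball ys r' y -> (g ys <= g y)%E.
  move=> /ball_r'[ye _]; rewrite fG_ys leNgt; apply/negP => gy.
  have gyE : g y = (fine (g y))%:E.
    by rewrite fineK// ge0_fin_numE ?radial_dual_ge0// (lt_le_trans gy)// leey.
  have g0 : 0 <= fine (g y) by rewrite fine_ge0// radial_dual_ge0.
  move: gy; rewrite gyE lte_fin => gy.
  (* A positive height strictly between [g y] and [vs] and within [e] of [vs]: Gamma sends (y, w)
     into hypo f near [xs], at height 1 / w > f xs. The midpoint keeps [w] positive even when [g y]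
     is 0. *)
  pose w := Num.max ((fine (g y) + vs) / 2) (vs - e / 2).
  have w1 : (fine (g y) + vs) / 2 <= w by rewrite le_max lexx.
  have w2 : vs - e / 2 <= w by rewrite le_max lexx orbT.
  have w3 : w < vs by rewrite gt_max; apply/andP; split; lra.
  have w0 : 0 < w by lra.
  have : epigraph g (y, w) by split=> //=; rewrite gyE lee_fin; lra.
  rewrite epi_g => -[_ [_ /= wf]].
  have /e_ball : `|y - ys| < e by [].
  move=> /(_ w); rewrite ltr0_norm ?subr_lt0// => /(_ (ltac:(lra))) /xs_loj[fle _].
  have := le_trans wf fle; rewrite f_xs lee_fin usE lef_pV2 ?posrE//.
  by rewrite leNgt w3.
pose B := `|ys| + 1.
(* Lower bound for 1 / (v vs), the ratio of f xs - f x to v - vs. *)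
pose k := ((vs + 1) * vs)^-1.
have B_gt0 : 0 < B by rewrite ltr_wpDl.
have k_gt0 : 0 < k by rewrite invr_gt0 mulr_gt0// addr_gt0.
(* [C1] bounds [|z|] from below when <z, y> >= v / 2; in [C2], the factor vs / 2 is a lower bound
   for v - <z, y> in the other case. *)
pose C1 := vs / (2 * B).
pose C2 := vs / 2 * (C * k `^ theta).
have C1_gt0 : 0 < C1 by rewrite divr_gt0// mulr_gt0.
have C2_gt0 : 0 < C2 by rewrite !mulr_gt0 ?invr_gt0// powR_gt0.
exists r', (Num.min C1 C2); split=> //; first by rewrite lt_min C1_gt0.
move=> y yr'; split; first exact: g_ge.
have [ye Lye] := ball_r' y yr'.
apply: le_ereal_inf_tmp => _ [z [/andP[gy0 gyoo] nz] <-].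
have [v gyE] : exists v, g y = v%:E.
  by exists (fine (g y)); rewrite fineK// ge0_fin_numE// ltW.
rewrite -/g gyE /= in nz gy0 *; rewrite fG_ys -EFinB.
have v_gt0 : 0 < v by rewrite -lte_fin.
have vs_le : vs <= v by have := g_ge y yr'; rewrite fG_ys gyE.
have v_le : v <= vs + L * `|y - ys| by have := g_cone y; rewrite gyE.
(* When g y = g ys the left side vanishes, also for theta = 0 by the convention on 0^0. *)
rewrite /lpow; case: ifPn => [_|]; first by rewrite mule0 lee_fin.
rewrite eqe subr_eq0 eq_sym => v_neq.
have {v_neq} vs_lt : vs < v by rewrite lt_neqAle v_neq.
rewrite poweR_EFin -EFinM lee_fin.
set P := (v - vs) `^ theta.
have P_ge0 : 0 <= P by exact: powR_ge0.
have theta_ge0 : 0 <= theta by case/andP: theta01.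
have y_le : `|y| <= B.
  by rewrite -(subrK ys y) addrC (le_trans (ler_normD _ _))// lerD2l; lra.
have [zy|zy] := lerP (v / 2) (dot z y).
  have P_le1 : P <= 1.
    have <- : 1 `^ theta = 1 by rewrite powR1.
    by rewrite ge0_ler_powR ?nnegrE//; lra.
  apply: (@le_trans _ _ (C1 * 1)); first by rewrite ler_pM// ?ge_min ?lexx// le_min !ltW.
  rewrite mulr1 ler_pdivrMr ?mulr_gt0//.
  have := dot_le_norm dot dotE z y.
  have : `|z| * `|y| <= `|z| * B by rewrite ler_wpM2l.
  lra.
(* Vertical component of the transferred normal; its positivity puts (x, 1 / v) on the graph of [f]
   and allows rescaling this component to 1. *)
pose d := v - dot z y.
have d_gt : v / 2 < d by rewrite /d; lra.
have d_gt0 : 0 < d by lra.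
pose x := v^-1 *: y.
have nx : prox_normal dot (hypograph f) (x, v^-1) (z, d).
  have := prox_normal_radial_dual dot dotE f f_usc M M_gt0 f_le f_rad y v z (-1) nz.
  by rewrite mulN1r opprB.
have fx := prox_normal_hypograph _ _ _ _ _ _ _ _ (f_lty x) d_gt0 nx.
have sup_x : prox_sup dot f x (- (d^-1 *: z)).
  split; first by rewrite /in_posR fx lte_fin invr_gt0 v_gt0 ltry.
  have zdE : d^-1 *: ((z, d) : E * R) = (d^-1 *: z, 1).
    by congr pair; rewrite /= -[LHS]/(d^-1 * d) mulVf ?gt_eqF.
  have d'_gt0 : 0 < d^-1 by rewrite invr_gt0.
  by rewrite fx opprK -zdE; exact: prox_normalZ d'_gt0 nx.
have xr : ball xs r x.
  apply: e_ball => //; rewrite gtr0_norm ?subr_gt0//; lra.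
have [_ loj] := xs_loj x xr.
have {}loj : (C%:E * lpow (f xs - f x) theta <= `|- (d^-1 *: z)|%:E)%E.
  by apply: le_trans loj _; apply: ereal_inf_lbound; exists (- (d^-1 *: z)).
have gap : (v - vs) * k <= us - v^-1.
  have -> : us - v^-1 = (v - vs) * (v * vs)^-1.
    by rewrite usE; field; rewrite !gt_eqF.
  rewrite ler_wpM2l ?subr_ge0// lef_pV2 ?posrE ?mulr_gt0 ?addr_gt0//.
  by rewrite ler_wpM2r ?ltW//; lra.
have gap0 : 0 < (v - vs) * k by rewrite mulr_gt0// subr_gt0.
move: loj; rewrite fx f_xs -EFinB /lpow gt_eqF; last first.
  by rewrite lte_fin (lt_le_trans gap0).
rewrite poweR_EFin -EFinM lee_fin normrN normrZ normfV gtr0_norm//.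
rewrite ler_pdivlMl// => loj.
(* Monotonicity of the power carries [gap] over to the exponent theta, with the same exponent on
   both sides. *)
have Pk : P * k `^ theta <= (us - v^-1) `^ theta.
  rewrite -powRM ?subr_ge0 ?(ltW k_gt0)//.
  by apply: ge0_ler_powR; rewrite ?nnegrE ?(ltW gap0)// (le_trans (ltW gap0)).
apply: (@le_trans _ _ (C2 * P)); first by rewrite ler_wpM2r// ge_min lexx orbT.
apply: le_trans loj; rewrite /C2.
have -> : vs / 2 * (C * k `^ theta) * P = vs / 2 * (C * (P * k `^ theta)) by ring.
apply: ler_pM.
- lra.
- by rewrite !mulr_ge0 ?powR_ge0// ltW.
- lra.
- by rewrite ler_wpM2l// ltW.
Qed.
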